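(* (Subject Reduction) In the Fitch-style calculus for $IK$: if $\Gamma\vdash t:A$ is derivable and $t\mapsto u$, then $\Gamma\vdash u:A$ is derivable.
   Context: Types: $A,B ::= p \mid 1 \mid A\times B \mid A\to B \mid 0 \mid A+B \mid \Box A$ ($p$ atoms). Contexts: $\Gamma ::= \cdot \mid \Gamma,x:A \mid \Gamma,\bullet$ (variables distinct; $\bullet$ is a structural symbol called a lock). Terms: $x$, $\langle\rangle$, $\langle t,u\rangle$, $\pi_1 t$, $\pi_2 t$, $\lambda x.t$, $t\,u$, $\mathrm{inl}\,t$, $\mathrm{inr}\,t$, $\mathrm{case}\ s\ \mathrm{of}\ (x.t;\,y.u)$, $\mathrm{abort}\,t$, $\mathrm{shut}\,t$, $\mathrm{open}\,t$. Typing rules: (var) $\Gamma,x:A,\Gamma'\vdash x:A$ provided $\Gamma'$ contains no lock; (products) $\Gamma\vdash\langle\rangle:1$; from $\Gamma\vdash t:A$, $\Gamma\vdash u:B$ infer $\Gamma\vdash\langle t,u\rangle:A\times B$; from $\Gamma\vdash t:A_1\times A_2$ infer $\Gamma\vdash\pi_i t:A_i$; (functions) from $\Gamma,x:A\vdash t:B$ infer $\Gamma\vdash\lambda x.t:A\to B$; from $\Gamma\vdash t:A\to B$, $\Gamma\vdash u:A$ infer $\Gamma\vdash t\,u:B$; (sums) from $\Gamma\vdash t:A$ infer $\Gamma\vdash\mathrm{inl}\,t:A+B$; symmetrically for $\mathrm{inr}$; from $\Gamma\vdash s:A+B$, $\Gamma,x:A,\Gamma'\vdash t:C$, $\Gamma,y:B,\Gamma'\vdash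 u:C$ infer $\Gamma,\Gamma'\vdash\mathrm{case}\ s\ \mathrm{of}\ (x.t;\,y.u):C$ (any $\Gamma'$); from $\Gamma\vdash t:0$ infer $\Gamma,\Gamma'\vdash\mathrm{abort}\,t:A$ (any $\Gamma'$); (shut) from $\Gamma,\bullet\vdash t:A$ infer $\Gamma\vdash\mathrm{shut}\,t:\Box A$; (open) from $\Gamma\vdash t:\Box A$ infer $\Gamma,\bullet,\Gamma'\vdash\mathrm{open}\,t:A$ provided $\Gamma'$ contains no lock. Reduction: $\mapsto$ is the closure under all term formers (reduction anywhere inside a term) of the rules $(\lambda x.t)\,u\mapsto t[u/x]$; $\pi_i\langle t_1,t_2\rangle\mapsto t_i$; $\mathrm{case}\ (\mathrm{inl}\,s)\ \mathrm{of}\ (x.t;\,y.u)\mapsto t[s/x]$; $\mathrm{case}\ (\mathrm{inr}\,s)\ \mathrm{of}\ (x.t;\,y.u)\mapsto u[s/y]$; $\mathrm{open}\,\mathrm{shut}\,t\mapsto t$; and the commuting conversions $E[\mathrm{case}\ s\ \mathrm{of}\ (x.t;\,y.u)]\mapsto\mathrm{case}\ s\ \mathrm{of}\ (x.E[t];\,y.E[u])$ and $E[\mathrm{abort}\,t]\mapsto\mathrm{abort}\,t$ for every elimination frame $E[-]$ among $[-]\,v$, $\pi_1[-]$, $\pi_2[-]$, $\mathrm{case}\ [-]\ \mathrm{of}\ (x'.t';\,y'.u')$, $\mathrm{abort}[-]$, $\mathrm{open}[-]$ (in particular $\mathrm{open}\,(\mathrm{case}\ s\ \mathrm{of}\ (x.t;\,y.u))\mapsto\mathrm{case}\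 s\ \mathrm{of}\ (x.\mathrm{open}\,t;\,y.\mathrm{open}\,u)$ and $\mathrm{open}\,\mathrm{abort}\,t\mapsto\mathrm{abort}\,t$). *)

(* Defs.v *)
From mathcomp Require Import all_boot.

Set Implicit Arguments.
Unset Strict Implicit.
Unset Printing Implicit Defensive.

Inductive ty (P : Type) : Type :=
| Atom of P
| One
| Prod of ty P & ty P
| Arr of ty P & ty P
| Zero
| Sum of ty P & ty P
| Box of ty P.

Arguments One {P}.
Arguments Zero {P}.

Definition name := nat.

(* Terms are taken up to renaming of bound variables, in locally nameless
   style: free variables are names, bound variables are de Bruijn indices.
   [Lam] binds index 0 in its argument and [Case s t u] binds index 0 in [t]
   and, separately, in [u].  The terms of the calculus are the locally closed
   ones; every typable term is locally closed.

   Names rather than positions are needed for free variables, because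
   the typing rule for [Case] inserts the bound variable in the middle of the
   context. *)
Inductive tm : Type :=
| FVar of name
| BVar of nat
| Unit
| Pair of tm & tm
| Fst of tm
| Snd of tm
| Lam of tm
| App of tm & tm
| Inl of tm
| Inr of tm
| Case of tm & tm & tm
| Abort of tm
| Shut of tm
| Open of tm.

Fixpoint fv (t : tm) : seq name :=
  match t with
  | FVar x => [:: x]
  | BVar _ | Unit => [::]
  | Fst t | Snd t | Lam t | Inl t | Inr t | Abort t | Shut t | Open t => fv t
  | Pair t u | App t u => fv t ++ fv u
  | Case s t u => fv s ++ fv t ++ fv u
  end.

(* [inst k v t] replaces the index [k] of [t] by [v].  Since [v] is meant to be
   locally closed, it is not shifted when going under binders. *)
Fixpoint inst (k : nat) (v : tm) (t : tm) : tm :=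
  match t with
  | FVar x => FVar x
  | BVar i => if i == k then v else BVar i
  | Unit => Unit
  | Pair t u => Pair (inst k v t) (inst k v u)
  | Fst t => Fst (inst k v t)
  | Snd t => Snd (inst k v t)
  | Lam t => Lam (inst k.+1 v t)
  | App t u => App (inst k v t) (inst k v u)
  | Inl t => Inl (inst k v t)
  | Inr t => Inr (inst k v t)
  | Case s t u => Case (inst k v s) (inst k.+1 v t) (inst k.+1 v u)
  | Abort t => Abort (inst k v t)
  | Shut t => Shut (inst k v t)
  | Open t => Open (inst k v t)
  end.

(* If [t] is the scope of a binder, then [subst0 t v] is the usual t[v/x], and
   [subst0 t (FVar x)], for [x] not free in [t], is the scope itself with its
   bound variable named [x]. *)
Definition subst0 (t v : tm) : tm := inst 0 v t.

Inductive entry (P : Type) : Type :=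
| Bind of name & ty P
| Lock.

Arguments Lock {P}.

(* Contexts are listed from left to right, the most recent entry last. *)
Definition ctx (P : Type) := seq (entry P).

Definition dom (P : Type) (G : ctx P) : seq name :=
  pmap (fun e => if e is Bind x _ then Some x else None) G.

Definition distinct (P : Type) (G : ctx P) : bool := uniq (dom G).

Definition lock_free (P : Type) (G : ctx P) : bool :=
  all (fun e => if e is Lock then false else true) G.

(* Contexts have distinct variables: [typing G t A] entails [distinct G].  This
   is required explicitly only where it does not follow from the premises.  In
   particular the name chosen for a bound variable is fresh for the context. *)
Inductive typing (P : Type) : ctx P -> tm -> ty P -> Prop :=
| T_var G G' x A :
    distinct (G ++ Bind x A :: G') -> lock_free G' ->
    typing (G ++ Bind x A :: G') (FVar x) A
| T_unit G :
    distinct G -> typing G Unit One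
| T_pair G t u A B :
    typing G t A -> typing G u B -> typing G (Pair t u) (Prod A B)
| T_fst G t A B :
    typing G t (Prod A B) -> typing G (Fst t) A
| T_snd G t A B :
    typing G t (Prod A B) -> typing G (Snd t) B
| T_lam G x t A B :
    x \notin fv t ->
    typing (G ++ [:: Bind x A]) (subst0 t (FVar x)) B ->
    typing G (Lam t) (Arr A B)
| T_app G t u A B :
    typing G t (Arr A B) -> typing G u A -> typing G (App t u) B
| T_inl G t A B :
    typing G t A -> typing G (Inl t) (Sum A B)
| T_inr G t A B :
    typing G t B -> typing G (Inr t) (Sum A B)
| T_case G G' x y s t u A B C :
    x \notin fv t -> y \notin fv u ->
    typing G s (Sum A B) ->
    typing (G ++ Bind x A :: G') (subst0 t (FVar x)) C ->
    typing (G ++ Bind y B :: G') (subst0 u (FVar y)) C ->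
    typing (G ++ G') (Case s t u) C
| T_abort G G' t A :
    distinct (G ++ G') ->
    typing G t Zero -> typing (G ++ G') (Abort t) A
| T_shut G t A :
    typing (G ++ [:: Lock]) t A -> typing G (Shut t) (Box A)
| T_open G G' t A :
    distinct (G ++ Lock :: G') -> lock_free G' ->
    typing G t (Box A) -> typing (G ++ Lock :: G') (Open t) A.

Inductive frame : Type :=
| FrApp of tm
| FrFst
| FrSnd
| FrCase of tm & tm
| FrAbort
| FrOpen.

Definition plug (E : frame) (t : tm) : tm :=
  match E with
  | FrApp v => App t v
  | FrFst => Fst t
  | FrSnd => Snd t
  | FrCase t' u' => Case t t' u'
  | FrAbort => Abort t
  | FrOpen => Open t
  end.

(* In [R_comm_case] the frame moves under the binders of [Case].  As [E] is a
   frame of a locally closed term, it contains no index pointing outside of it,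
   so no shift is needed and no capture occurs. *)
Inductive contract : tm -> tm -> Prop :=
| R_beta t u : contract (App (Lam t) u) (subst0 t u)
| R_fst t u : contract (Fst (Pair t u)) t
| R_snd t u : contract (Snd (Pair t u)) u
| R_inl s t u : contract (Case (Inl s) t u) (subst0 t s)
| R_inr s t u : contract (Case (Inr s) t u) (subst0 u s)
| R_open_shut t : contract (Open (Shut t)) t
| R_comm_case E s t u :
    contract (plug E (Case s t u)) (Case s (plug E t) (plug E u))
| R_comm_abort E t : contract (plug E (Abort t)) (Abort t).

Inductive red : tm -> tm -> Prop :=
| C_contract t u : contract t u -> red t u
| C_pair_l t t' u : red t t' -> red (Pair t u) (Pair t' u)
| C_pair_r t u u' : red u u' -> red (Pair t u) (Pair t u')
| C_fst t t' : red t t' -> red (Fst t) (Fst t')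
| C_snd t t' : red t t' -> red (Snd t) (Snd t')
| C_lam x t t' :
    x \notin fv t -> x \notin fv t' ->
    red (subst0 t (FVar x)) (subst0 t' (FVar x)) -> red (Lam t) (Lam t')
| C_app_l t t' u : red t t' -> red (App t u) (App t' u)
| C_app_r t u u' : red u u' -> red (App t u) (App t u')
| C_inl t t' : red t t' -> red (Inl t) (Inl t')
| C_inr t t' : red t t' -> red (Inr t) (Inr t')
| C_case s s' t u : red s s' -> red (Case s t u) (Case s' t u)
| C_case_l x s t t' u :
    x \notin fv t -> x \notin fv t' ->
    red (subst0 t (FVar x)) (subst0 t' (FVar x)) ->
    red (Case s t u) (Case s t' u)
| C_case_r y s t u u' :
    y \notin fv u -> y \notin fv u' ->
    red (subst0 u (FVar y)) (subst0 u' (FVar y)) ->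
    red (Case s t u) (Case s t u')
| C_abort t t' : red t t' -> red (Abort t) (Abort t')
| C_shut t t' : red t t' -> red (Shut t) (Shut t')
| C_open t t' : red t t' -> red (Open t) (Open t').

(* Main.v *)
(* A derivation is stable under the renamings that may also insert bindings
   anywhere in the context, since new bindings never separate a variable or an
   [Open] from what it refers to by a lock.  This weakening yields the
   substitution lemma: when the [Case] or [Open] rule drops the part of the
   context holding the substituted variable, that variable does not occur in the
   premise.  It also serves for the commuting conversions: the arguments of the
   frame move to a context extended in the middle by the variable of the branch. *)
Require Import Defs.
From mathcomp Require Import all_boot.

Set Implicit Arguments.
Unset Strict Implicit.
Unset Printing Implicit Defensive.

(** * Simultaneous substitution and local closure *)

(** Simultaneous, so that one operation covers both renamings, [FVar \o f], and the substitution of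
    a single term, [[eta FVar with x |-> u]]. *)
Fixpoint sub (s : name -> tm) (t : tm) : tm :=
  match t with
  | FVar x => s x
  | BVar i => BVar i
  | Unit => Unit
  | Pair t u => Pair (sub s t) (sub s u)
  | Fst t => Fst (sub s t)
  | Snd t => Snd (sub s t)
  | Lam t => Lam (sub s t)
  | App t u => App (sub s t) (sub s u)
  | Inl t => Inl (sub s t)
  | Inr t => Inr (sub s t)
  | Case r t u => Case (sub s r) (sub s t) (sub s u)
  | Abort t => Abort (sub s t)
  | Shut t => Shut (sub s t)
  | Open t => Open (sub s t)
  end.

(** Closure is encoded as invariance under instantiation, the form in which [sub_inst] uses it. *)
Definition locally_closed (t : tm) : Prop := forall k v, inst k v t = t.

Lemma eq_in_sub s s' t : {in fv t, s =1 s'} -> sub s t = sub s' t.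
Proof.
elim: t => //=; try by [move=> t IH /IH -> | move=> x; apply; rewrite inE].
- by move=> t IHt u IHu E; rewrite IHt ?IHu // => x xt; apply: E;
    rewrite mem_cat xt ?orbT.
- by move=> t IHt u IHu E; rewrite IHt ?IHu // => x xt; apply: E;
    rewrite mem_cat xt ?orbT.
- by move=> r IHr t IHt u IHu E; rewrite IHr ?IHt ?IHu // => x xt; apply: E;
    rewrite !mem_cat xt ?orbT.
Qed.

Lemma sub_id t : sub FVar t = t.
Proof.
by elim: t => //= [t -> u ->|t ->|t ->|t ->|t -> u ->|t ->|t ->|r -> t -> u ->
  |t ->|t ->|t ->].
Qed.

Lemma fv_sub s t y : y \in fv (sub s t) -> exists2 x, x \in fv t & y \in fv (s x).
Proof.
elim: t => //=; first by move=> x; exists x; rewrite ?inE.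
- move=> t IHt u IHu; rewrite mem_cat => /orP[/IHt|/IHu] [x xt yx];
    by exists x; rewrite // mem_cat xt ?orbT.
- move=> t IHt u IHu; rewrite mem_cat => /orP[/IHt|/IHu] [x xt yx];
    by exists x; rewrite // mem_cat xt ?orbT.
- move=> r IHr t IHt u IHu; rewrite !mem_cat => /or3P[/IHr|/IHt|/IHu] [x xt yx];
    by exists x; rewrite // !mem_cat xt ?orbT.
Qed.

Lemma sub_inst s k v t : (forall x, locally_closed (s x)) ->
  sub s (inst k v t) = inst k (sub s v) (sub s t).
Proof.
move=> lcs; elim: t k => //= [x k|i k|t IHt u IHu k|t IH k|t IH k|t IH k
  |t IHt u IHu k|t IH k|t IH k|r IHr t IHt u IHu k|t IH k|t IH k|t IH k];
  rewrite ?IH ?IHr ?IHt ?IHu ?lcs //.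
by case: eqP.
Qed.

(** The passage under a binder: naming the bound variable [x] and then sending [x] to [w] amounts to
    instantiating it by [w], as [x] occurs nowhere else in the scope. *)
Lemma sub_open s x w t : (forall y, locally_closed (s y)) -> locally_closed w ->
  x \notin fv t ->
  sub [eta s with x |-> w] (subst0 t (FVar x)) = subst0 (sub s t) w.
Proof.
move=> lcs lcw xt; rewrite /subst0 sub_inst => [/=|y /=]; last by case: eqP.
rewrite eqxx; congr inst; apply: eq_in_sub => y yt /=.
by case: eqP yt xt => // -> ->.
Qed.

Lemma mem_fv_inst k v t x : x \in fv t -> x \in fv (inst k v t).
Proof.
elim: t k => //= [t IHt u IHu k|t IH k|t IHt u IHu k|r IHr t IHt u IHu k].
- by rewrite !mem_cat => /orP[/IHt ->|/IHu ->]; rewrite ?orbT.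
- exact: IH.
- by rewrite !mem_cat => /orP[/IHt ->|/IHu ->]; rewrite ?orbT.
- by rewrite !mem_cat => /or3P[/IHr ->|/IHt ->|/IHu ->]; rewrite ?orbT.
Qed.

(** Instantiating [j] leaves every occurrence of the other index [i] in place, so whatever
    instantiating [i] would change in [t], it would still change afterwards. *)
Lemma inst_inst_id i j u v t : i != j ->
  inst i u (inst j v t) = inst j v t -> inst i u t = t.
Proof.
elim: t i j => //= [k|t IHt t' IHt'|t IH|t IH|t IH|t IHt t' IHt'|t IH|t IH
  |r IHr t IHt t' IHt'|t IH|t IH|t IH] i j ij.
- by case: (k =P j) => // -> _; rewrite eq_sym (negPf ij).
- by move=> [/(IHt _ _ ij) -> /(IHt' _ _ ij) ->].
- by move=> [/(IH _ _ ij) ->].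
- by move=> [/(IH _ _ ij) ->].
- by move=> [/(IH i.+1 j.+1 ij) ->].
- by move=> [/(IHt _ _ ij) -> /(IHt' _ _ ij) ->].
- by move=> [/(IH _ _ ij) ->].
- by move=> [/(IH _ _ ij) ->].
- by move=> [/(IHr _ _ ij) -> /(IHt i.+1 j.+1 ij) -> /(IHt' i.+1 j.+1 ij) ->].
- by move=> [/(IH _ _ ij) ->].
- by move=> [/(IH _ _ ij) ->].
- by move=> [/(IH _ _ ij) ->].
Qed.

(** Only index 0 is filled when the scope is named, and [k.+1] differs from it. This carries local
    closure through the binders in [typing_lc]. *)
Lemma inst_scope_id x t k v :
  locally_closed (subst0 t (FVar x)) -> inst k.+1 v t = t.
Proof. by move=> lct; apply: (@inst_inst_id _ 0 _ (FVar x)) => //; apply: lct. Qed.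

(** * Fresh names and splittings of sequences *)

Lemma exists_fresh (s : seq name) : exists z, z \notin s.
Proof.
exists (\max_(x <- s) x).+1; apply/negP => zs.
by have := @leq_bigmax_seq _ s xpredT id _ zs isT; rewrite ltnn.
Qed.

(** Locates the entry [e] relative to the cut between [G1] and [G2]; the typing rules cut the
    context at places unrelated to the substituted variable. *)
Lemma cat_eq_mid (T : Type) (G1 G2 H1 H2 : seq T) e :
  G1 ++ G2 = H1 ++ e :: H2 ->
  (exists K, G1 = H1 ++ e :: K /\ H2 = K ++ G2) \/
  (exists K, H1 = G1 ++ K /\ G2 = K ++ e :: H2).
Proof.
elim: G1 H1 => [|a G1 IH] [|b H1] /=.
- by move=> ->; right; exists [::].
- by move=> ->; right; exists (b :: H1).
- by case=> -> <-; left; exists G1.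
- case=> -> /IH [[K [-> ->]]|[K [-> ->]]]; first by left; exists K.
  by right; exists K.
Qed.

(** * Contexts and invariants of typing derivations *)

Section Contexts.

Variable P : Type.
Implicit Types (G D : ctx P) (A B : ty P).

Lemma dom_cat G D : dom (G ++ D) = dom G ++ dom D.
Proof. exact: pmap_cat. Qed.

Lemma lock_free_cat G D : lock_free (G ++ D) = lock_free G && lock_free D.
Proof. exact: all_cat. Qed.

Lemma distinct_bind G D x A :
  distinct (G ++ Bind x A :: D) = (x \notin dom (G ++ D)) && distinct (G ++ D).
Proof.
by rewrite /distinct !dom_cat /= -cat1s uniq_catCA.
Qed.

Lemma distinct_cat G D : distinct (G ++ D) -> distinct G.
Proof. by rewrite /distinct dom_cat cat_uniq => /andP[]. Qed.

Lemma distinct_lock G D : distinct (G ++ Lock :: D) = distinct (G ++ D).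
Proof. by rewrite /distinct !dom_cat. Qed.

Lemma typing_distinct G t A : typing G t A -> distinct G.
Proof.
elim=> {G t A} // [G x t A B _ _|G G' x y s t u A B C _ _ _ _ _ IH _ _|G t A _].
- by rewrite distinct_bind cats0 => /andP[].
- by move: IH; rewrite distinct_bind => /andP[].
- by rewrite distinct_lock cats0.
Qed.

Lemma typing_lc G t A : typing G t A -> locally_closed t.
Proof.
elim=> {G t A} //= [G t u A B _ IHt _ IHu|G t A B _ IH|G t A B _ IH
  |G x t A B _ _ IH|G t u A B _ IHt _ IHu|G t A B _ IH|G t A B _ IH
  |G G' x y s t u A B C _ _ _ IHs _ IHt _ IHu|G G' t A _ _ IH|G t A _ IH
  |G G' t A _ _ _ IH] k v /=; rewrite ?IH ?IHt ?IHu ?IHs //.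
- by rewrite (inst_scope_id _ _ IH).
- by rewrite (inst_scope_id _ _ IHt) (inst_scope_id _ _ IHu).
Qed.

Lemma typing_fv G t A : typing G t A -> {subset fv t <= dom G}.
Proof.
elim=> {G t A} //= [G G' x A _ _|G t u A B _ IHt _ IHu|G x t A B xt _ IH
  |G t u A B _ IHt _ IHu|G G' x y s t u A B C xt yu _ IHs _ IHt _ IHu
  |G G' t A _ _ IH|G t A _ IH|G G' t A _ _ _ IH] z.
- by rewrite inE => /eqP ->; rewrite dom_cat mem_cat /= inE eqxx orbT.
- by rewrite mem_cat => /orP[/IHt|/IHu].
- move=> zt; have := IH _ (mem_fv_inst _ _ zt).
  by rewrite dom_cat mem_cat /= inE => /orP[//|/eqP E]; rewrite -E zt in xt.
- by rewrite mem_cat => /orP[/IHt|/IHu].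
- rewrite !mem_cat dom_cat mem_cat => /or3P[/IHs -> //|zt|zu].
  + have := IHt _ (mem_fv_inst _ _ zt); rewrite dom_cat mem_cat /= inE.
    by case/or3P=> [->|/eqP E|->]; rewrite ?orbT //; rewrite -E zt in xt.
  + have := IHu _ (mem_fv_inst _ _ zu); rewrite dom_cat mem_cat /= inE.
    by case/or3P=> [->|/eqP E|->]; rewrite ?orbT //; rewrite -E zu in yu.
- by move=> /IH; rewrite dom_cat mem_cat => ->.
- by move=> /IH; rewrite dom_cat mem_cat /= orbF.
- by move=> /IH; rewrite dom_cat mem_cat => ->.
Qed.

(** * Weakening and renaming *)

(** Order-preserving embeddings of contexts along [f]. Only bindings may be inserted, so a lock-free
    stretch stays lock-free. *)
Inductive wk (f : name -> name) : ctx P -> ctx P -> Prop :=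
| wk_nil : wk f [::] [::]
| wk_lock G D : wk f G D -> wk f (Lock :: G) (Lock :: D)
| wk_bind x A G D : wk f G D -> wk f (Bind x A :: G) (Bind (f x) A :: D)
| wk_skip y B G D : wk f G D -> wk f G (Bind y B :: D).

Lemma wk_cat f G G' D D' :
  wk f G D -> wk f G' D' -> wk f (G ++ G') (D ++ D').
Proof. by move=> w w'; elim: w => //= *; constructor. Qed.

Lemma wk_refl G : wk id G G.
Proof.
elim: G => [|[x A|] G IH]; [exact: wk_nil| |exact: wk_lock].
exact: (wk_bind (f := id)).
Qed.

Lemma wk_lock_free_skip f D : lock_free D -> wk f [::] D.
Proof. by elim: D => [|[x A|] D IH] //= => [_|/IH]; constructor. Qed.

Lemma wk_cat_inv f G G' E : wk f (G ++ G') E ->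
  exists D D', [/\ E = D ++ D', wk f G D & wk f G' D'].
Proof.
move H: (G ++ G') => K w; elim: w G G' H => {K E} [|K E w IH|x A K E w IH
  |y B K E w IH] G G'.
- by case: G => //= ->; exists [::], [::]; split=> //; constructor.
- case: G => [/= ->|e G /= [-> /IH [D [D' [-> wD wD']]]]].
    by exists [::], (Lock :: E); split=> //; constructor.
  by exists (Lock :: D), D'; split=> //; constructor.
- case: G => [/= ->|e G /= [-> /IH [D [D' [-> wD wD']]]]].
    by exists [::], (Bind (f x) A :: E); split=> //; constructor.
  by exists (Bind (f x) A :: D), D'; split=> //; constructor.
- move=> /IH [D [D' [-> wD wD']]].
  by exists (Bind y B :: D), D'; split=> //; constructor.
Qed.

Lemma wk_cons_inv f e G E : wk f (e :: G) E ->
  exists D D', [/\ E = D ++ (if e is Bind x A then Bind (f x) A else Lock) :: D',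
                   wk f [::] D & wk f G D'].
Proof.
move H: (e :: G) => K w; elim: w H => {K E} [|K E w _|x A K E w _
  |y B K E w IH] //.
- by case=> -> ->; exists [::], E; split=> //; constructor.
- by case=> -> ->; exists [::], E; split=> //; constructor.
- move=> /IH [D [D' [-> wD wD']]].
  by exists (Bind y B :: D), D'; split=> //; constructor.
Qed.

Lemma wk_mid_inv f e G G' E : wk f (G ++ e :: G') E ->
  exists D D', [/\ E = D ++ (if e is Bind x A then Bind (f x) A else Lock) :: D',
                   wk f G D & wk f G' D'].
Proof.
case/wk_cat_inv=> D [_ [-> wD /wk_cons_inv [K [D' [-> wK wD']]]]].
(* The bindings inserted just before the image of [e] are counted with the image of [G]. *)
exists (D ++ K), D'; split=> //; first by rewrite -catA.
by rewrite -[G]cats0; apply: wk_cat.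
Qed.

Lemma wk_lock_free f G D : wk f G D -> lock_free G -> lock_free D.
Proof. by elim. Qed.

Lemma wk_dom f G D x : wk f G D -> x \in dom G -> f x \in dom D.
Proof.
elim=> {G D} //= [y A G D _ IH|y B G D _ IH /IH]; rewrite !inE.
  by case/predU1P=> [->|/IH ->]; rewrite ?eqxx ?orbT.
by move=> ->; rewrite orbT.
Qed.

Lemma eq_in_wk f g G D : {in dom G, f =1 g} -> wk f G D -> wk g G D.
Proof.
move=> E w; elim: w E => {G D} [|G D w IH|x A G D w IH|y B G D w IH] E.
- exact: wk_nil.
- by apply/wk_lock/IH.
- rewrite E ?inE ?eqxx //; apply/wk_bind/IH => y yG.
  by apply: E; rewrite inE yG orbT.
- by apply/wk_skip/IH.
Qed.

(** As [x] is absent from [G] and [G'], redirecting it to [z] does not disturb the two embeddings;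
    this takes a renaming under a binder. *)
Lemma wk_extend f x z A G G' D D' : x \notin dom (G ++ G') ->
  wk f G D -> wk f G' D' ->
  wk [eta f with x |-> z] (G ++ Bind x A :: G') (D ++ Bind z A :: D').
Proof.
rewrite dom_cat mem_cat negb_or => /andP[xG xG'] w w'; apply: wk_cat.
  apply: eq_in_wk w => y /= yG; case: eqP => // E.
  by rewrite -E yG in xG.
have -> : Bind z A = Bind ([eta f with x |-> z] x) A by rewrite /= eqxx.
apply: wk_bind; apply: eq_in_wk w' => y /= yG; case: eqP => // E.
by rewrite -E yG in xG'.
Qed.

Lemma sub_ren_open f x z t : x \notin fv t ->
  sub (FVar \o [eta f with x |-> z]) (subst0 t (FVar x)) =
  subst0 (sub (FVar \o f) t) (FVar z).
Proof.
move=> xt; rewrite -(@sub_open _ x) //.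
by apply: eq_in_sub => y _ /=; case: eqP.
Qed.

Lemma notin_fv_ren f z t D :
  (forall x, x \in fv t -> f x \in dom D) -> z \notin dom D ->
  z \notin fv (sub (FVar \o f) t).
Proof.
move=> fD zD; apply/negP => /fv_sub [x xt]; rewrite inE => /eqP zE.
by rewrite zE fD in zD.
Qed.

(** Every free name of [t] stays free once the scope is named, hence lies in the extended context,
    and it cannot be [x]. *)
Lemma typing_fv_scope G G' x A t B : x \notin fv t ->
  typing (G ++ Bind x A :: G') (subst0 t (FVar x)) B ->
  {subset fv t <= dom (G ++ G')}.
Proof.
move=> xt /typing_fv sG y yt; have := sG y (mem_fv_inst _ _ yt).
rewrite !dom_cat !mem_cat /= inE orbCA => /predU1P[E|//].
by rewrite -E yt in xt.
Qed.

(* The bound variables of the derivation may clash with the inserted bindings: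
   letting the renaming vary absorbs the change of names under binders. *)
Lemma typing_wk G t A f D : typing G t A -> wk f G D -> distinct D ->
  typing D (sub (FVar \o f) t) A.
Proof.
move=> tt; elim: tt f D => {G t A} /= [G G' x A dG lG|G dG|G t u A B _ IHt _ IHu
  |G t A B _ IH|G t A B _ IH|G x t A B xt tt IH|G t u A B _ IHt _ IHu
  |G t A B _ IH|G t A B _ IH
  |G G' x y s t u A B C xt yu ts IHs tt IHt tu IHu|G G' t A dG _ IH|G t A _ IH
  |G G' t A dG lG _ IH] f D w dD.
- have [D1 [D2 [E _ w2]]] := wk_mid_inv w; rewrite E in dD *.
  by apply: T_var => //; apply: wk_lock_free w2 lG.
- exact: T_unit.
- by apply: T_pair; [apply: IHt|apply: IHu].
- by apply: T_fst; apply: IH.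
- by apply: T_snd; apply: IH.
- have [z zD] := exists_fresh (dom D).
  have := typing_distinct tt; rewrite distinct_bind => /andP[xG _].
  apply: (@T_lam _ _ z).
    apply: notin_fv_ren zD => y yt; apply: wk_dom w _.
    by rewrite -[G]cats0; apply: typing_fv_scope tt _ yt.
  rewrite -(@sub_ren_open _ x) //; apply: IH; last first.
    by rewrite distinct_bind cats0 zD.
  by apply: wk_extend => //; apply: wk_nil.
- by apply: T_app; [apply: IHt|apply: IHu].
- by apply: T_inl; apply: IH.
- by apply: T_inr; apply: IH.
- have [D1 [D2 [E w1 w2]]] := wk_cat_inv w; rewrite E in w dD *.
  have [z zD] := exists_fresh (dom (D1 ++ D2)).
  have := typing_distinct tt; rewrite distinct_bind => /andP[xG _].
  have := typing_distinct tu; rewrite distinct_bind => /andP[yG _].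
  apply: (@T_case _ _ _ z z _ _ _ A B).
  + apply: notin_fv_ren zD => n nt; apply: wk_dom w _.
    exact: typing_fv_scope tt _ nt.
  + apply: notin_fv_ren zD => n nt; apply: wk_dom w _.
    exact: typing_fv_scope tu _ nt.
  + by apply: IHs => //; apply: distinct_cat dD.
  + rewrite -(@sub_ren_open _ x) //; apply: IHt; first exact: wk_extend.
    by rewrite distinct_bind zD.
  + rewrite -(@sub_ren_open _ y) //; apply: IHu; first exact: wk_extend.
    by rewrite distinct_bind zD.
- have [D1 [D2 [E w1 w2]]] := wk_cat_inv w; rewrite E in dD *.
  by apply: T_abort => //; apply: IH => //; apply: distinct_cat dD.
- apply: T_shut; apply: IH; last by rewrite distinct_lock cats0.
  by apply: wk_cat => //; apply/wk_lock/wk_nil.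
- have [D1 [D2 [E w1 w2]]] := wk_mid_inv w; rewrite E in dD *.
  apply: T_open => //; first exact: wk_lock_free w2 lG.
  by apply: IH => //; apply: distinct_cat dD.
Qed.

Lemma typing_weaken G K G' t A : typing (G ++ G') t A -> lock_free K ->
  distinct (G ++ K ++ G') -> typing (G ++ K ++ G') t A.
Proof.
move=> tt lK dG; rewrite -[t]sub_id; apply: typing_wk tt _ dG.
apply: wk_cat; first exact: wk_refl.
by apply: (@wk_cat _ [::]); [exact: wk_lock_free_skip|exact: wk_refl].
Qed.

Lemma typing_weaken_bind G x B G' t A : typing (G ++ G') t A ->
  distinct (G ++ Bind x B :: G') -> typing (G ++ Bind x B :: G') t A.
Proof. by move=> tt; apply: (@typing_weaken _ [:: Bind x B]). Qed.

(** * Substitution for a single variable *)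

Lemma sub_update_open x y u t : locally_closed u -> y != x ->
  subst0 (sub [eta FVar with x |-> u] t) (FVar y) =
  sub [eta FVar with x |-> u] (subst0 t (FVar y)).
Proof.
move=> lcu /negPf yx; rewrite /subst0 sub_inst /= ?yx // => n /=.
by case: eqP.
Qed.

Lemma sub_update_fresh x u t : x \notin fv t -> sub [eta FVar with x |-> u] t = t.
Proof.
move=> xt; rewrite -[RHS]sub_id; apply: eq_in_sub => y yt /=.
by case: eqP => // E; rewrite -E yt in xt.
Qed.

Lemma fv_sub_update x u t y :
  y \in fv (sub [eta FVar with x |-> u] t) -> (y \in fv u) || (y \in fv t).
Proof.
by case/fv_sub=> n nt /=; case: eqP => [_ ->//|_]; rewrite inE => /eqP ->;
  rewrite nt orbT.
Qed.

(** Since [u] is typed in the part before [x], extensions of the context after [x] leave its typing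
    alone; it is weakened only at an occurrence of [x] and where [Case] binds a variable inside
    [G]. *)
Lemma typing_subst G x A G' t B u :
  typing (G ++ Bind x A :: G') t B -> typing G u A ->
  typing (G ++ G') (sub [eta FVar with x |-> u] t) B.
Proof.
move H: (G ++ Bind x A :: G') => H0 tt.
have dH := typing_distinct tt.
elim: tt G G' H dH => {H0 t B} /= [H H' y B _ lH|H _|H t t' B C _ IHt _ IHt'
  |H t B C _ IH|H t B C _ IH|H y t B C yt tt IH|H t t' B C _ IHt _ IHt'
  |H t B C _ IH|H t B C _ IH
  |H H' y z s t t' B B' C yt zt' ts IHs tt IHt tt' IHt'|H H' t B _ ts IH
  |H t B tt IH|H H' t B _ lH ts IH] G G' E.
all: rewrite -E distinct_bind => /andP[xG dG] tu; have lcu := typing_lc tu.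
all: have dE : distinct (G ++ Bind x A :: G') by rewrite distinct_bind xG.
(* Three cases: [y] lies after [x], is [x] itself, or lies before [x]. *)
- have [[K [EH EG']]|[[|e K] [EG]]] := cat_eq_mid (esym E).
  + have /negPf -> : y != x.
      by apply: contraNneq xG => <-; rewrite EG' !dom_cat !mem_cat /= inE eqxx !orbT.
    by rewrite EG' catA; apply: T_var => //; rewrite -catA -EG'.
  (* The stretch [G'] after [x] is lock-free by the variable rule, so [u] weakens across it. *)
  + case=> -> -> EH'; rewrite eqxx -[G']cats0.
    apply: typing_weaken; rewrite ?cats0 // -EH' //.
  + case=> Ee EH'; rewrite EG -Ee -catA /= in xG dG *.
    have /negPf -> : y != x.
      by apply: contraNneq xG => <-; rewrite !dom_cat mem_cat /= inE eqxx !orbT.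
    apply: T_var => //; move: lH.
    by rewrite EH' !lock_free_cat /= => /andP[-> ->].
- exact: T_unit.
- by apply: T_pair; [apply: IHt|apply: IHt']; rewrite -?E.
- by apply: T_fst; apply: IH; rewrite -?E.
- by apply: T_snd; apply: IH; rewrite -?E.
- have := typing_distinct tt; rewrite distinct_bind cats0 -E => /andP[yG _].
  have yx : y != x.
    by apply: contraNneq yG => ->; rewrite dom_cat mem_cat /= inE eqxx orbT.
  apply: (@T_lam _ _ y).
    apply/negP => /fv_sub_update /orP[/(typing_fv tu) yu|yt'].
      by rewrite dom_cat mem_cat yu in yG.
    by rewrite yt' in yt.
  rewrite sub_update_open // -catA.
  by apply: IH tu; [rewrite -E -catA|apply: typing_distinct tt].
- by apply: T_app; [apply: IHt|apply: IHt']; rewrite -?E.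
- by apply: T_inl; apply: IH; rewrite -?E.
- by apply: T_inr; apply: IH; rewrite -?E.
- have dt := typing_distinct tt; have dt' := typing_distinct tt'.
  have := dt; rewrite distinct_bind -E => /andP[yG _].
  have := dt'; rewrite distinct_bind -E => /andP[zG _].
  have fresh w r : w \notin dom (G ++ Bind x A :: G') -> w \notin fv r ->
      w \notin fv (sub [eta FVar with x |-> u] r).
    move=> wG wr; apply/negP => /fv_sub_update /orP[/(typing_fv tu) wu|wr'].
      by rewrite dom_cat mem_cat wu in wG.
    by rewrite wr' in wr.
  have neq w : w \notin dom (G ++ Bind x A :: G') -> w != x.
    by apply: contraNneq => ->; rewrite dom_cat mem_cat /= inE eqxx orbT.
  have [[K [EH EG']]|[K [EG EH']]] := cat_eq_mid (esym E).
  + rewrite EG' catA; apply: (@T_case _ _ _ y z _ _ _ B B').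
    * exact: fresh.
    * exact: fresh.
    * by apply: IHs tu => //; apply: typing_distinct ts.
    * rewrite sub_update_open ?neq // -catA; apply: IHt tu => //.
      by rewrite EH -catA.
    * rewrite sub_update_open ?neq // -catA; apply: IHt' tu => //.
      by rewrite EH -catA.
  (* Here [x] lies in the part that the scrutinee does not see, so [s] is unchanged; the branch
     variable is inserted inside [G], and [u] has to follow by weakening. *)
  + rewrite EG -catA; apply: (@T_case _ _ _ y z _ _ _ B B').
    * exact: fresh.
    * exact: fresh.
    * rewrite sub_update_fresh //; apply: contra xG => /(typing_fv ts).
      by rewrite EG !dom_cat !mem_cat => ->.
    * rewrite sub_update_open ?neq // -cat_cons catA; apply: IHt => //.
        by rewrite EH' -catA.
      apply: typing_weaken_bind; first by rewrite -EG.
      by apply: (@distinct_cat _ (Bind x A :: G')); rewrite -catA /= -EH'.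
    * rewrite sub_update_open ?neq // -cat_cons catA; apply: IHt' => //.
        by rewrite EH' -catA.
      apply: typing_weaken_bind; first by rewrite -EG.
      by apply: (@distinct_cat _ (Bind x A :: G')); rewrite -catA /= -EH'.
- have [[K [EH EG']]|[K [EG EH']]] := cat_eq_mid (esym E).
  + rewrite EG' catA; apply: T_abort; first by rewrite -catA -EG'.
    by apply: IH tu => //; apply: typing_distinct ts.
  + rewrite sub_update_fresh; last first.
      apply: contra xG => /(typing_fv ts).
      by rewrite EG !dom_cat !mem_cat => ->.
    by move: dG; rewrite EG -catA => dG; apply: T_abort.
- apply: T_shut; rewrite -catA; apply: IH tu; last exact: typing_distinct tt.
  by rewrite -E -catA.
- have [[K [EH EG']]|[[|e K] [EG]]] := cat_eq_mid (esym E) => //.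
  + rewrite EG' catA; apply: T_open; rewrite -?catA -?EG' //.
    by apply: IH tu => //; apply: typing_distinct ts.
  (* The lock of the rule lies before [x], so the premise is typed in a prefix without [x]. *)
  + case=> Ee EH'; rewrite sub_update_fresh; last first.
      apply: contra xG => /(typing_fv ts).
      by rewrite EG !dom_cat !mem_cat => ->.
    move: dG; rewrite EG -Ee -catA /= => dG; apply: T_open => //; move: lH.
    by rewrite EH' !lock_free_cat /= => /andP[-> ->].
Qed.

(** [subst0 t u] is the scope named by [x] followed by the substitution of [u] for [x]; beta and the
    contractions of [Case] on injections have this form. *)
Lemma typing_subst0 G x A G' t u B : x \notin fv t ->
  typing (G ++ Bind x A :: G') (subst0 t (FVar x)) B -> typing G u A ->
  typing (G ++ G') (subst0 t u) B.
Proof.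
move=> xt tt tu; have := typing_subst tt tu.
by rewrite sub_open ?sub_id //; apply: typing_lc tu.
Qed.

(** * Change of bound names and inversion of typing *)

Lemma typing_rename G x A G' t z B : x \notin fv t -> z \notin dom (G ++ G') ->
  typing (G ++ Bind x A :: G') (subst0 t (FVar x)) B ->
  typing (G ++ Bind z A :: G') (subst0 t (FVar z)) B.
Proof.
move=> xt zG tt; have /andP[xG dG] : (x \notin dom (G ++ G')) && distinct (G ++ G').
  by rewrite -(distinct_bind _ _ _ A); apply: typing_distinct tt.
rewrite -{1}[t]sub_id -(@sub_ren_open id x) //; apply: typing_wk tt _ _.
  by apply: wk_extend => //; apply: wk_refl.
by rewrite distinct_bind zG.
Qed.

Lemma typing_pair_inv G t u C : typing G (Pair t u) C ->
  exists A B, [/\ C = Prod A B, typing G t A & typing G u B].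
Proof. by move=> tt; inversion tt; subst; do 2 eexists; split; eauto. Qed.

Lemma typing_fst_inv G t A : typing G (Fst t) A -> exists B, typing G t (Prod A B).
Proof. by move=> tt; inversion tt; subst; eexists; eauto. Qed.

Lemma typing_snd_inv G t B : typing G (Snd t) B -> exists A, typing G t (Prod A B).
Proof. by move=> tt; inversion tt; subst; eexists; eauto. Qed.

(** The rule supplies one name; renaming replaces it by one that avoids any list [L], chosen to suit
    the term to be typed next. *)
Lemma typing_lam_inv (L : seq name) G t C : typing G (Lam t) C ->
  exists x A B, [/\ C = Arr A B, x \notin L, x \notin fv t &
                    typing (G ++ [:: Bind x A]) (subst0 t (FVar x)) B].
Proof.
move=> tt; inversion tt as [| | | | |G0 x t' A B xt tx| | | | | | |]; subst.
have [z] := exists_fresh (L ++ fv t ++ dom (G ++ [::])).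
rewrite !mem_cat !negb_or => /and3P[zL zt zG].
by exists z, A, B; split=> //; apply: typing_rename tx.
Qed.

Lemma typing_app_inv G t u B : typing G (App t u) B ->
  exists2 A, typing G t (Arr A B) & typing G u A.
Proof. by move=> tt; inversion tt; subst; eexists; eauto. Qed.

Lemma typing_inl_inv G t C : typing G (Inl t) C ->
  exists A B, C = Sum A B /\ typing G t A.
Proof. by move=> tt; inversion tt; subst; do 2 eexists; split; eauto. Qed.

Lemma typing_inr_inv G t C : typing G (Inr t) C ->
  exists A B, C = Sum A B /\ typing G t B.
Proof. by move=> tt; inversion tt; subst; do 2 eexists; split; eauto. Qed.

Lemma typing_abort_inv G t A : typing G (Abort t) A ->
  exists G0 G1, [/\ G = G0 ++ G1, distinct G & typing G0 t Zero].
Proof. by move=> tt; inversion tt; subst; do 2 eexists; split; eauto. Qed.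

Lemma typing_shut_inv G t C : typing G (Shut t) C ->
  exists2 A, C = Box A & typing (G ++ [:: Lock]) t A.
Proof. by move=> tt; inversion tt; subst; eexists; eauto. Qed.

Lemma typing_open_inv G t A : typing G (Open t) A ->
  exists G0 G1, [/\ G = G0 ++ Lock :: G1, distinct G, lock_free G1 &
                    typing G0 t (Box A)].
Proof. by move=> tt; inversion tt; subst; do 2 eexists; split; eauto. Qed.

(** The branches are renamed independently, so they can share one name that avoids [L] and the
    context. *)
Lemma typing_case_inv (L : seq name) G s t u C : typing G (Case s t u) C ->
  exists G0 G1 x A B,
    [/\ G = G0 ++ G1, x \notin L ++ dom G, typing G0 s (Sum A B),
        x \notin fv t /\ typing (G0 ++ Bind x A :: G1) (subst0 t (FVar x)) C &
        x \notin fv u /\ typing (G0 ++ Bind x B :: G1) (subst0 u (FVar x)) C].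
Proof.
move=> tt; inversion tt as [| | | | | | | | |G0 G1 x y s' t' u' A B C' xt yu ts
  tt' tu' E| | |]; subst.
have [z] := exists_fresh ((L ++ dom (G0 ++ G1)) ++ fv t ++ fv u).
rewrite [z \in _ ++ _ ++ _]mem_cat [z \in fv t ++ _]mem_cat !negb_or.
case/and3P=> zL zt zu; have zG : z \notin dom (G0 ++ G1).
  by move: zL; rewrite mem_cat negb_or => /andP[].
exists G0, G1, z, A, B; split=> //; split=> //.
  exact: typing_rename tt'.
exact: typing_rename tu'.
Qed.

(** * Commuting conversions *)

(** The arguments of the frame contain no index pointing outside, so instantiation reaches only the
    hole. *)
Lemma subst0_plug E r t v : locally_closed (plug E r) ->
  subst0 (plug E t) v = plug E (subst0 t v).
Proof.
rewrite /subst0; case: E => //= [w|t' u'] /(_ 0 v) /= [_].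
  by move=> ->.
by move=> -> ->.
Qed.

(** Besides the part [G0] of the context seen by the hole, this gives what a commuting conversion
    needs: the frame can be refilled after a binding is inserted inside [G0], as happens when it
    moves into a branch. *)
Lemma typing_plug G E r C : typing G (plug E r) C ->
  exists A G0 G1, [/\ G = G0 ++ G1, typing G0 r A &
    forall K K' x B r', G0 = K ++ K' -> x \notin dom G ->
      typing (K ++ Bind x B :: K') r' A ->
      typing (K ++ Bind x B :: K' ++ G1) (plug E r') C].
Proof.
move=> tt; have dG := typing_distinct tt.
have dE K K' G1 x B : G = (K ++ K') ++ G1 -> x \notin dom G ->
    distinct (K ++ Bind x B :: K' ++ G1).
  by move=> EG xG; rewrite distinct_bind catA -EG xG.
case: E tt => /= [v|||t' u'||].
- case/typing_app_inv=> A tr tv; exists (Arr A C), G, [::].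
  rewrite cats0; split=> // K K' x B r' EG xG tr'.
  apply: T_app; rewrite cats0; first exact: tr'.
  apply: typing_weaken_bind; first by rewrite -EG.
  exact: typing_distinct tr'.
- case/typing_fst_inv=> B tr; exists (Prod C B), G, [::].
  by rewrite cats0; split=> // K K' x D r' _ _ tr'; rewrite cats0; apply: T_fst tr'.
- case/typing_snd_inv=> A tr; exists (Prod A C), G, [::].
  by rewrite cats0; split=> // K K' x D r' _ _ tr'; rewrite cats0; apply: T_snd tr'.
- case/(typing_case_inv [::])=> G0 [G1 [y [A [B [EG yG tr [yt tt'] [yu tu']]]]]].
  exists (Sum A B), G0, G1; split=> // K K' x D r' EG0 xG tr'.
  have dx : distinct (K ++ Bind x D :: K' ++ G1) by apply: dE; rewrite // -EG0.
  (* [z] must avoid [x] too, since the branches of the frame are now typed below the inserted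
     binding. *)
  have [z] := exists_fresh (dom (K ++ Bind x D :: K' ++ G1) ++ fv t' ++ fv u').
  rewrite !mem_cat !negb_or => /and3P[zx zt zu].
  have zG : z \notin dom (G0 ++ G1).
    apply: contra zx; rewrite EG0 !dom_cat /= !dom_cat !(mem_cat, inE).
    by rewrite -orbA => /or3P[] ->; rewrite ?orbT.
  have dz F : distinct (K ++ Bind x D :: K' ++ Bind z F :: G1).
    rewrite -cat_cons catA distinct_bind -catA /= zx //.
  rewrite -cat_cons catA; apply: (@T_case _ _ _ z z _ _ _ A B) => //.
  + rewrite -catA; apply: typing_weaken_bind (dz _).
    by rewrite catA -EG0; apply: typing_rename tt'.
  + rewrite -catA; apply: typing_weaken_bind (dz _).
    by rewrite catA -EG0; apply: typing_rename tu'.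
- case/typing_abort_inv=> G0 [G1 [EG _ tr]]; exists Zero, G0, G1.
  split=> // K K' x B r' EG0 xG tr'; rewrite -cat_cons catA; apply: T_abort => //.
  by rewrite -catA; apply: dE; rewrite // -EG0.
(* The lock belongs to the part that the hole does not see, so the insertion stays before it. *)
- case/typing_open_inv=> G0 [G1 [EG _ lG tr]]; exists (Box C), G0, (Lock :: G1).
  split=> // K K' x B r' EG0 xG tr'; rewrite -cat_cons catA; apply: T_open => //.
  by rewrite -catA; apply: dE; rewrite // -EG0.
Qed.

(** [Abort] takes any type and may drop any suffix of the context, so the suffix dropped by the
    frame is merged with its own. *)
Lemma typing_abort_plug G E t C :
  typing G (plug E (Abort t)) C -> typing G (Abort t) C.
Proof.
move=> tt; have := typing_distinct tt.
have [A [G0 [G1 [-> /typing_abort_inv [K [K' [-> _ tK]]] _]]]] := typing_plug tt.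
by rewrite -catA => dG; apply: T_abort.
Qed.

Lemma typing_case_plug G E s t u C :
  typing G (plug E (Case s t u)) C -> typing G (Case s (plug E t) (plug E u)) C.
Proof.
move=> tt; have lcE := typing_lc tt.
have [A [G0 [G1 [EG ts wkE]]]] := typing_plug tt.
(* [x] must be fresh for the new branches, where it is bound again, and for [G], as [typing_plug]
   requires. *)
have [K [K' [x [B [B' [EG0 xL tK [xt tx] [xu ux]]]]]]] :=
  typing_case_inv (fv (plug E t) ++ fv (plug E u) ++ dom G) ts.
move: xL; rewrite !mem_cat -!orbA !negb_or => /and4P[xEt xEu xG _].
rewrite EG EG0 -catA; apply: (@T_case _ _ _ x x _ _ _ B B') => //.
  by rewrite (subst0_plug _ _ lcE); apply: wkE.
by rewrite (subst0_plug _ _ lcE); apply: wkE.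
Qed.

(** * Preservation of types by a contraction *)

Lemma typing_contract G t u A : typing G t A -> contract t u -> typing G u A.
Proof.
move=> tt c; case: c tt => {t u} [t u|t u|t u|s t u|s t u|t|E s t u|E t].
- case/typing_app_inv=> B /(typing_lam_inv [::]) [x [B' [A' [[-> ->] _ xt tt]]]] tu.
  by rewrite -[G]cats0; apply: typing_subst0 tt tu.
- by case/typing_fst_inv=> B /typing_pair_inv [? [? [[-> _]]]].
- by case/typing_snd_inv=> B /typing_pair_inv [? [? [[_ ->]]]].
- case/(typing_case_inv [::])=> G0 [G1 [x [B [B' [-> _ ts [xt tt] _]]]]].
  have [? [? [[EB _] tB]]] := typing_inl_inv ts.
  by apply: typing_subst0 tt _ => //; rewrite EB.
- case/(typing_case_inv [::])=> G0 [G1 [x [B [B' [-> _ ts _ [xu tu]]]]]].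
  have [? [? [[_ EB] tB]]] := typing_inr_inv ts.
  by apply: typing_subst0 tu _ => //; rewrite EB.
- case/typing_open_inv=> G0 [G1 [-> dG lG /typing_shut_inv [? [<-] tt]]].
  (* [t] is typed in [G0] followed by the lock; the lock-free [G1] is appended by weakening. *)
  rewrite -cat1s catA -[G1]cats0; apply: typing_weaken; rewrite ?cats0 //.
  by rewrite -catA.
- exact: typing_case_plug.
- exact: typing_abort_plug.
Qed.

End Contexts.

(** * Reduction inside a term *)

(** Substitution preserves the shape of a redex, acting on the arguments of its frame, and commutes
    with [subst0] by local closure. *)
Lemma sub_contract s t u : (forall x, locally_closed (s x)) ->
  contract t u -> contract (sub s t) (sub s u).
Proof.
move=> lcs; have subE E r : sub s (plug E r) = plug
    (match E with
     | FrApp v => FrApp (sub s v) | FrFst => FrFst | FrSnd => FrSnd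
     | FrCase t u => FrCase (sub s t) (sub s u)
     | FrAbort => FrAbort | FrOpen => FrOpen end) (sub s r) by case: E.
by case=> *; rewrite /subst0 /= ?subE /= ?subE ?sub_inst //; constructor.
Qed.

(* Quantifying over renamings lets the hypothesis, available for one name of
   the bound variable, be used at the name chosen by the typing derivation. *)
Lemma typing_red_ren t u : red t u -> forall (P : Type) f (G : ctx P) A,
  typing G (sub (FVar \o f) t) A -> typing G (sub (FVar \o f) u) A.
Proof.
elim=> {t u} /= [t u c|t t' u _ IH|t u u' _ IH|t t' _ IH|t t' _ IH
  |x t t' xt xt' _ IH|t t' u _ IH|t u u' _ IH|t t' _ IH|t t' _ IH
  |s s' t u _ IH|x s t t' u xt xt' _ IH|x s t u u' xu xu' _ IH
  |t t' _ IH|t t' _ IH|t t' _ IH] P f G C.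
- by move=> tt; apply: typing_contract tt _; apply: sub_contract.
- by case/typing_pair_inv=> A [B [-> /IH tt tu]]; apply: T_pair.
- by case/typing_pair_inv=> A [B [-> tt /IH tu]]; apply: T_pair.
- by case/typing_fst_inv=> B /IH; apply: T_fst.
- by case/typing_snd_inv=> A /IH; apply: T_snd.
(* The name avoids the free names of the reduct, which becomes the new scope. *)
- case/(typing_lam_inv (fv (sub (FVar \o f) t')))=> y [A [B [-> yt' _]]].
  rewrite -(@sub_ren_open _ x) // => /IH.
  by rewrite sub_ren_open //; apply: T_lam.
- by case/typing_app_inv=> A /IH tt tu; apply: T_app tu.
- by case/typing_app_inv=> A tt /IH tu; apply: T_app tu.
- by case/typing_inl_inv=> A [B [-> /IH tt]]; apply: T_inl.
- by case/typing_inr_inv=> A [B [-> /IH tt]]; apply: T_inr.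
- case/(typing_case_inv [::])=> G0 [G1 [y [A [B [-> _ /IH ts [yt tt] [yu tu]]]]]].
  exact: T_case tt tu.
- case/(typing_case_inv (fv (sub (FVar \o f) t'))).
  move=> G0 [G1 [y [A [B [-> yL ts [_ tt] [yu tu]]]]]].
  move: yL; rewrite mem_cat negb_or => /andP[yt' _].
  apply: T_case ts _ tu => //; first exact: yt'.
  by move: tt; rewrite -!(@sub_ren_open _ x) //; apply: IH.
- case/(typing_case_inv (fv (sub (FVar \o f) u'))).
  move=> G0 [G1 [y [A [B [-> yL ts [yt tt] [_ tu]]]]]].
  move: yL; rewrite mem_cat negb_or => /andP[yu' _].
  apply: T_case ts tt _ => //; first exact: yu'.
  by move: tu; rewrite -!(@sub_ren_open _ x) //; apply: IH.
- by case/typing_abort_inv=> G0 [G1 [-> dG /IH tt]]; apply: T_abort.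
- by case/typing_shut_inv=> A -> /IH; apply: T_shut.
- by case/typing_open_inv=> G0 [G1 [-> dG lG /IH tt]]; apply: T_open.
Qed.

Theorem theorem2 (P : Type) (G : ctx P) (t u : tm) (A : ty P) :
  typing G t A -> red t u -> typing G u A.
Proof.
by move=> tt r; rewrite -[u]sub_id; apply: (typing_red_ren r (f := id)); rewrite sub_id.
Qed.
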